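(* If $f:X\rightarrow Y$ is a bi-uniformly continuous surjection, where $X$ is a universal uniform space and $Y$ is a uniform space, then $Y$ is coverable.
   Context: Entourages of a uniform space are taken to be symmetric. For a map $f$ and a set of pairs $E$, $f(E)$ and $f^{-1}(E)$ mean $(f\times f)(E)$ and $(f\times f)^{-1}(E)$. Chains. Let $X$ be a uniform space with a fixed basepoint $\ast$. For an entourage $E$, an $E$-chain is a finite sequence $\{x_0,\dots,x_n\}$ in $X$ with $(x_i,x_{i+1})\in E$ for all $i$. An $E$-homotopy of an $E$-chain is a finite sequence of moves, each adding or removing one point (never an endpoint), so that the result of each move is again an $E$-chain (a one-point chain $\{x\}$ is identified with $\{x,x\}$). $[\alpha]_E$ denotes the $E$-homotopy class of $\alpha$. The spaces $X_E$. $X_E$ is the set of $E$-homotopy classes of $E$-chains starting at $\ast$. For an entourage $F\subset E$, $F^{\ast}$ is the set of pairs $([\alpha]_E,[\beta]_E)$ such that, for some points $x_0=\ast,x_1,\dots,x_{n-1},x,y$ (where $n\ge 1$), $[\alpha]_E=[x_0,\dots,x_{n-1},x]_E$, $[\beta]_E=[x_0,\dots,x_{n-1},y]_E$ and $(x,y)\in F$. The sets $F^{\ast}$ ($F\subset E$) form a basis of the uniform structure of $X_E$. $\phi_{XE}:X_E\to X$ is the endpoint map, and for $F\subset E$, $\phi_{EF}:X_F\to X_E$ is $\phi_{EF}([\alpha]_F)=[\alpha]_E$. The space $\widetilde X$. $\widetilde X$ is the inverse limit of the system $(X_E,\phi_{EF})$, indexed by all entourages of $X$, with the inverse limit uniformity.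 $\phi_E:\widetilde X\to X_E$ are the projections, and $\phi:\widetilde X\to X$ is the endpoint map. (For chain connected spaces, i.e. those in which every pair of points is joined by an $E$-chain for every entourage $E$, nothing of consequence depends on the choice of basepoint.) $X$ is coverable if $\phi$ is surjective and $\phi_E$ is surjective for all $E$ in some basis of the uniform structure of $X$. An entourage $E$ of $X$ is universal if $\phi_{XE}:X_E\to X$ is a uniform homeomorphism; $X$ is universal if its uniform structure has a basis of universal entourages. A map is bi-uniformly continuous if the inverse image of every entourage is an entourage and the image of every entourage is an entourage in the subspace uniformity of the image of the map. *)

(* Defs.v *)
From HB Require Import structures.
From Stdlib Require Import Relations.
From mathcomp Require Import all_boot all_order all_algebra.
From mathcomp Require Import all_classical all_reals all_analysis.

Set Implicit Arguments.
Unset Strict Implicit.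
Unset Printing Implicit Defensive.

Local Open Scope classical_set_scope.
Local Open Scope quotient_scope.

(* The entourages of [uniformType] need not be symmetric; those used to form
   chains are, so they are bundled with their symmetry. *)
Record sym_entourage (X : uniformType) := SymEntourage {
  ent_set :> set (X * X);
  ent_setP : entourage ent_set;
  ent_set_sym : (ent_set^-1)%relation = ent_set }.

Section sym_entourage_theory.
Context {X : uniformType}.
Implicit Types E F : sym_entourage X.

Lemma sym_entC E x y : ent_set E (x, y) -> ent_set E (y, x).
Proof. by move=> Exy; rewrite -(ent_set_sym E). Qed.

Lemma sym_ent_refl E x : ent_set E (x, x).
Proof. exact: entourage_refl (ent_setP E). Qed.

Definition sym_entT : sym_entourage X.
Proof. by exists setT => //; exact: entourageT. Defined.

Definition sym_entI E F : sym_entourage X.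
Proof.
exists (E `&` F); first by apply: filterI; exact: ent_setP.
by apply/seteqP; split=> -[x y] [Exy Fxy]; split; exact: sym_entC.
Defined.

Definition sym_ent_of (V : set (X * X)) : entourage V -> sym_entourage X.
Proof.
move=> entV; exists (V `&` V^-1)%relation; first exact: entourage_invI.
by apply/seteqP; split=> -[x y] [Vxy Vyx]; split.
Defined.

End sym_entourage_theory.

Definition uniform_basis (X : uniformType) (B : set (sym_entourage X)) :=
  forall V : set (X * X), entourage V -> exists2 E, B E & E `<=` V.

Section chains.
Context {X : choiceType}.
Implicit Types (E F : set (X * X)) (x y : X) (s t : seq X).

Definition is_chain E s : bool :=
  if s is x :: p then path (fun y z => (y, z) \in E) x p else false.

(* [move_dup] is the identification of the one-point chain {x} with {x, x}. *)
Inductive chain_move : seq X -> seq X -> Prop :=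
| move_add s t x : s <> [::] -> t <> [::] -> chain_move (s ++ t) (s ++ x :: t)
| move_dup x : chain_move [:: x] [:: x; x].

Definition chain_step E s t :=
  [/\ is_chain E s, is_chain E t & chain_move s t \/ chain_move t s].

Definition homotopic E : seq X -> seq X -> Prop :=
  clos_refl_trans (seq X) (chain_step E).

Lemma chain_stepC E s t : chain_step E s t -> chain_step E t s.
Proof. by case=> cs ct [] m; split=> //; [right|left]. Qed.

Lemma homotopicC E s t : homotopic E s t -> homotopic E t s.
Proof.
elim=> [u v /chain_stepC|u|u v w _ vu _ wv]; first exact: rt_step.
- exact: rt_refl.
- exact: rt_trans vu.
Qed.

Lemma is_chainS E F s : F `<=` E -> is_chain F s -> is_chain E s.
Proof.
move=> FE; case: s => //= x p; apply: sub_path => y z /set_mem Fyz.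
by apply/mem_set/FE.
Qed.

Lemma homotopicS E F s t : F `<=` E -> homotopic F s t -> homotopic E s t.
Proof.
move=> FE; elim=> [u v [cu cv m]|u|u v w _ uv _ vw].
- by apply: rt_step; split=> //; exact: is_chainS FE _.
- exact: rt_refl.
- exact: rt_trans vw.
Qed.

Lemma homotopic_last E x0 s t :
  homotopic E s t -> last x0 s = last x0 t.
Proof.
have mv u v : chain_move u v -> last x0 u = last x0 v.
  by case=> // a b y _; rewrite !last_cat; case: b.
elim=> [u v [_ _ [] /mv//]|//|u v w _ -> _ ->//].
Qed.

Lemma is_chain_rcons E s x : s <> [::] ->
  is_chain E (rcons s x) = is_chain E s && ((last x s, x) \in E).
Proof. by case: s => // y s _ /=; rewrite rcons_path. Qed.

Lemma chain_move_rcons s t x : s <> [::] ->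
  chain_move s t -> chain_move (rcons s x) (rcons t x).
Proof.
move=> _; case=> [a b y a0 b0|y].
  rewrite -!cats1 -!catA /=; apply: move_add => //.
  by case: b b0.
exact: (@move_add [:: y] [:: x] y).
Qed.

Lemma homotopic_is_chain E s t : homotopic E s t -> is_chain E s -> is_chain E t.
Proof. by elim=> [? ? [] //|//|? ? ? _ h1 _ h2 /h1 /h2]. Qed.

Lemma homotopic_rcons E s t x : is_chain E (rcons s x) ->
  s <> [::] -> homotopic E s t -> homotopic E (rcons s x) (rcons t x).
Proof.
move=> + + st; elim: {s t}st => [s t st|s|s t u st ihst tu ihtu] csx s0.
- have [cs ct m] := st.
  have t0 : t <> [::] by case: t ct {st m}.
  have lst := homotopic_last x (rt_step _ _ _ _ st).
  apply: rt_step; split=> //.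
    by move: csx; rewrite !is_chain_rcons// ct -lst => /andP[].
  by case: m => m; [left|right]; exact: chain_move_rcons.
- exact: rt_refl.
- have cs : is_chain E s by move: csx; rewrite is_chain_rcons// => /andP[].
  have ct := homotopic_is_chain st cs.
  have t0 : t <> [::] by case: t ct {st tu ihst ihtu}.
  apply: rt_trans (ihst csx s0) (ihtu _ t0).
  move: csx; rewrite !is_chain_rcons// ct -(homotopic_last x st).
  by case/andP.
Qed.

Lemma homotopic_insert E s x y : s <> [::] ->
    is_chain E (rcons (rcons s x) y) -> is_chain E (rcons s y) ->
  homotopic E (rcons (rcons s x) y) (rcons s y).
Proof.
move=> s0 c c'; apply: rt_step; split=> //; right.
by rewrite -!cats1 -catA /=; apply: move_add.
Qed.

Lemma homotopic_dup E x p :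
    is_chain E (x :: p) -> (last x p, last x p) \in E ->
  homotopic E (x :: p) (x :: rcons p (last x p)).
Proof.
move=> c El; apply: rt_step; split=> //; first by move: c; rewrite /= rcons_path => ->.
left; case/lastP: p c El => [|p y] c El /=; first exact: move_dup.
by rewrite last_rcons -!cats1 -catA; exact: (@move_add (x :: p) [:: y] y).
Qed.

End chains.

Section chain_space.
Context {X : uniformType} (x0 : X).
Implicit Types E F : sym_entourage X.

Definition chain_from (E : set (X * X)) (s : seq X) : bool :=
  is_chain E s && (head x0 s == x0).

Definition based_chain E := {s : seq X | chain_from E s}.

Definition BasedChain E (s : seq X) (cs : chain_from E s) : based_chain E :=
  exist (chain_from E) s cs.

Definition homotopicb E : rel (based_chain E) :=
  fun c d => `[< homotopic E (val c) (val d) >].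

Lemma homotopicb_refl E : reflexive (@homotopicb E).
Proof. by move=> c; apply/asboolP; exact: rt_refl. Qed.

Lemma homotopicb_sym E : symmetric (@homotopicb E).
Proof. by move=> c d; apply/asboolP/asboolP => /homotopicC. Qed.

Lemma homotopicb_trans E : transitive (@homotopicb E).
Proof.
by move=> c d e /asboolP dc /asboolP ce; apply/asboolP; exact: rt_trans ce.
Qed.

Canonical homotopicb_equiv E :=
  EquivRel (@homotopicb E) (@homotopicb_refl E) (@homotopicb_sym E)
    (@homotopicb_trans E).

(* X_E with basepoint x0; its uniformity is generated by the [star F] below. *)
Definition chain_space E := {eq_quot (homotopicb_equiv E)}.

HB.instance Definition _ E := EqQuotient.on (chain_space E).
HB.instance Definition _ E := Choice.on (chain_space E).

Definition chain_class E (c : based_chain E) : chain_space E := \pi c.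

Lemma chain_classP E (c d : based_chain E) :
  chain_class c = chain_class d <-> homotopic E (val c) (val d).
Proof.
split=> [/eqmodP/asboolP//|h]; apply/eqmodP; exact/asboolP.
Qed.

Lemma chain_classK E (a : chain_space E) : chain_class (repr a) = a.
Proof. exact: reprK. Qed.

(* F^*: the points x_0, ..., x_(n-1) are x0 :: p, so that n >= 1. *)
Definition star E (F : set (X * X)) : set (chain_space E * chain_space E) :=
  [set ab | exists p x y
      (cx : chain_from E (x0 :: rcons p x)) (cy : chain_from E (x0 :: rcons p y)),
    [/\ ab.1 = chain_class (BasedChain cx), ab.2 = chain_class (BasedChain cy)
      & F (x, y)]].

Definition chain_space_ent E : set_system (chain_space E * chain_space E) :=
  [set V | exists2 F : sym_entourage X, F `<=` E & star F `<=` V].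

Lemma star_subset E (F G : set (X * X)) : F `<=` G -> @star E F `<=` star G.
Proof.
by move=> FG ab [p [x [y [cx [cy [? ? /FG ?]]]]]]; exists p, x, y, cx, cy.
Qed.

Lemma chain_space_ent_filter E : Filter (@chain_space_ent E).
Proof.
split.
- by exists E.
- move=> V W [F FE FV] [G GE GW]; exists (sym_entI F G); first by move=> ? [/FE].
  by move=> ab FGab; split; [apply: FV|apply: GW];
    apply: star_subset FGab => ? [].
- by move=> V W VW [F FE FV]; exists F => // ab /FV /VW.
Qed.

Lemma chain_space_ent_diag E V : chain_space_ent (E := E) V -> diagonal `<=` V.
Proof.
move=> [F FE FV] [a b] /diagonalP <-; apply: FV.
rewrite -(chain_classK a); move: (repr a) => -[[|x p] //= cp].
have cp' := cp; move: cp' => /andP[/= c /eqP xE].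
rewrite xE in c cp *.
have cx : chain_from E (x0 :: rcons p (last x0 p)).
  rewrite /chain_from /= eqxx andbT rcons_path; apply/andP; split=> //.
  by apply/mem_set; exact: sym_ent_refl.
exists p, (last x0 p), (last x0 p), cx, cx.
have h : chain_class (BasedChain cp) = chain_class (BasedChain cx).
  apply/chain_classP => /=; apply: homotopic_dup => //.
  by apply/mem_set; exact: sym_ent_refl.
by split=> //=; exact: sym_ent_refl.
Qed.

Lemma chain_space_ent_inv E V :
  chain_space_ent (E := E) V -> chain_space_ent (V^-1)%relation.
Proof.
move=> [F FE FV]; exists F => // -[a b] [p [x [y [cx [cy [? ? Fxy]]]]]].
by apply: FV; exists p, y, x, cy, cx; split=> //; exact: sym_entC.
Qed.

Lemma chain_space_ent_split E V : chain_space_ent (E := E) V ->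
  exists2 W, chain_space_ent (E := E) W & (W \; W `<=` V)%relation.
Proof.
move=> [F FE FV].
pose G := sym_ent_of (entourage_split_ent (ent_setP F)).
have GF : G `<=` F by move=> xy [/(split_ent_subset (ent_setP F))].
exists (star G); first by exists G => // xy /GF /FE.
move=> [a c] [b /= [p [x [y [cx [cy [/= -> bE Gxy]]]]]]
                  [q [y' [z [cy' [cz [/= bE' -> Gyz]]]]]]].
apply: FV.
have /chain_classP/= h : chain_class (BasedChain cy) = chain_class (BasedChain cy').
  by rewrite -bE -bE'.
have yy' : y = y'.
  by have := homotopic_last x0 h; rewrite /= !last_rcons.
subst y'.
have Fxz : ent_set F (x, z).
  by apply: (entourage_split y (ent_setP F)); [case: Gxy|case: Gyz].
have Exx : (x, x) \in ent_set E by apply/mem_set; exact: sym_ent_refl.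
have Exy : (x, y) \in ent_set E by apply/mem_set/FE/GF.
have Eyz : (y, z) \in ent_set E by apply/mem_set/FE/GF.
have Exz : (x, z) \in ent_set E by apply/mem_set/FE.
have c1 : is_chain E (x0 :: rcons p x) by case/andP: (cx).
have c2 : is_chain E (x0 :: rcons p y) by case/andP: (cy).
have c3 : is_chain E (x0 :: rcons q y) by case/andP: (cy').
have c4 : is_chain E (x0 :: rcons q z) by case/andP: (cz).
have r u v w : is_chain E (x0 :: rcons u v) -> (v, w) \in ent_set E ->
    is_chain E (x0 :: rcons (rcons u v) w).
  by rewrite /= [path _ x0 (rcons (rcons _ _) _)]rcons_path last_rcons => -> ->.
have cxx : chain_from E (x0 :: rcons (rcons p x) x).
  by rewrite /chain_from eqxx andbT r.
have cxz : chain_from E (x0 :: rcons (rcons p x) z).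
  by rewrite /chain_from eqxx andbT r.
exists (rcons p x), x, z, cxx, cxz; split=> //=; apply/chain_classP => /=.
  have := homotopic_dup c1; rewrite last_rcons => /(_ Exx).
  by [].
(* q z ~ q y z ~ p y z ~ p x y z ~ p x z *)
apply: (@rt_trans _ _ _ (x0 :: rcons (rcons q y) z)).
  apply: homotopicC; apply: (@homotopic_insert _ E (x0 :: q) y z) => //.
  exact: r.
apply: (@rt_trans _ _ _ (x0 :: rcons (rcons p y) z)).
  apply: homotopicC.
  apply: (@homotopic_rcons _ E (x0 :: rcons p y) (x0 :: rcons q y) z) => //.
  exact: r.
apply: (@rt_trans _ _ _ (x0 :: rcons (rcons (rcons p x) y) z)).
  apply: homotopicC.
  apply: (@homotopic_rcons _ E (x0 :: rcons (rcons p x) y) (x0 :: rcons p y) z)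
    => //.
    by apply: (r (rcons p x)) => //; exact: r.
  by apply: (@homotopic_insert _ E (x0 :: p) x y) => //; exact: r.
apply: (@homotopic_insert _ E (x0 :: rcons p x) y z) => //.
- by apply: (r (rcons p x)) => //; exact: r.
- exact: r.
Qed.

HB.instance Definition _ E := isUniform.Build (chain_space E)
  (@chain_space_ent_filter E) (@chain_space_ent_diag E)
  (@chain_space_ent_inv E) (@chain_space_ent_split E).

(* phi_XE; by [endpoint_class] the choice of representative is immaterial. *)
Definition endpoint E (a : chain_space E) : X := last x0 (val (repr a)).

Lemma endpoint_class E (c : based_chain E) :
  endpoint (chain_class c) = last x0 (val c).
Proof.
by apply: (@homotopic_last _ E); apply/chain_classP; rewrite chain_classK.
Qed.

Lemma chain_fromS E F s : F `<=` E -> chain_from F s -> chain_from E s.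
Proof.
by move=> FE /andP[cs sx0]; rewrite /chain_from sx0 (is_chainS FE cs).
Qed.

Definition coarsen_chain E F (FE : F `<=` E) (c : based_chain F) :
  based_chain E := BasedChain (chain_fromS FE (valP c)).

(* phi_EF; by [coarsen_class] the choice of representative is immaterial. *)
Definition coarsen E F (FE : F `<=` E) (a : chain_space F) : chain_space E :=
  chain_class (coarsen_chain FE (repr a)).

Lemma coarsen_class E F (FE : F `<=` E) (c : based_chain F) :
  coarsen FE (chain_class c) = chain_class (coarsen_chain FE c).
Proof.
apply/chain_classP => /=; apply: (homotopicS FE).
by apply/chain_classP; rewrite chain_classK.
Qed.

(* The inverse limit of the X_E; its uniformity is that of a subspace of the
   product. *)
Definition tilde : uniformType := set_type
  [set a : prod_topology (fun E : sym_entourage X => chain_space E) |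
    forall E F (FE : F `<=` E), coarsen FE (a F) = a E].

Definition tilde_proj E (a : tilde) : chain_space E := set_val a E.

(* phi; by [tilde_endpointE] any entourage could be used in place of the full
   one. *)
Definition tilde_endpoint (a : tilde) : X := endpoint (tilde_proj sym_entT a).

Lemma tilde_endpointE E a : tilde_endpoint a = endpoint (tilde_proj E a).
Proof.
have ET : E `<=` @sym_entT X by [].
rewrite /tilde_endpoint.
have <- : coarsen ET (tilde_proj E a) = tilde_proj sym_entT a.
  exact: (set_valP a).
move: (tilde_proj E a) => b.
by rewrite -[b]chain_classK coarsen_class !endpoint_class.
Qed.

Definition coverable :=
  set_surj [set: tilde] [set: X] tilde_endpoint /\
  exists2 B, uniform_basis B &
    forall E, B E -> set_surj [set: tilde] [set: chain_space E] (@tilde_proj E).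

End chain_space.

Definition uniform_homeo (X Y : uniformType) (f : X -> Y) :=
  exists g : Y -> X,
    [/\ cancel f g, cancel g f, unif_continuous f & unif_continuous g].

Definition universal_ent (X : uniformType) (x0 : X) (E : sym_entourage X) :=
  uniform_homeo (@endpoint X x0 E).

Definition universal_space (X : uniformType) (x0 : X) :=
  exists2 B : set (sym_entourage X), uniform_basis B &
    B `<=` universal_ent x0.

Definition map_pair (X Y : Type) (f : X -> Y) (xy : X * X) : Y * Y :=
  (f xy.1, f xy.2).

(* The entourages of the subspace uniformity of the image are the traces of
   the entourages of Y on it. *)
Definition bi_unif_continuous (X Y : uniformType) (f : X -> Y) :=
  (forall V : sym_entourage Y, entourage (map_pair f @^-1` V)) /\
  (forall E : sym_entourage X,
    exists2 V : set (Y * Y), entourage V &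
      map_pair f @` E = V `&` (range f `*` range f)).

(* Main.v *)
Require Import Defs.
From Stdlib Require Import Relations.
From mathcomp Require Import all_boot all_order all_algebra.
From mathcomp Require Import all_classical all_reals all_analysis.

Local Open Scope classical_set_scope.

(** Since [f] is bi-uniformly continuous and onto, the images [f(E)] of the
    universal entourages [E] of [X] form a basis of [Y]; the point is to lift
    the class of an [f(E)]-chain of [Y] to a point of the inverse limit.

    An [f(E)]-chain of [Y] need not be the image of an [E]-chain of [X], but
    each of its steps is the image [(f a, f b)] of some [(a, b)] in [E], and it
    is enough to treat the steps one at a time.  Given an entourage [D] of [Y],
    pick a universal entourage [U] that [f] maps into [D], join [a] to [b] by a
    [U]-chain, and take its image, a [D]-chain from [f a] to [f b].

    Universality of an entourage [E] means that any two points are joined by an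
    [E]-chain, unique up to [E]-homotopy ([universal_chain],
    [universal_homotopic]).  Comparing through a common universal refinement,
    the [D]-homotopy class of the image chain is therefore independent of [U]
    and of the [U]-chain ([universal_image_homotopic]).  The classes obtained
    for all [D] are thus compatible, and for [D = f(E)] the class is that of
    the original step, because [a, b] is itself an [E]-chain.  Concatenating
    over the steps gives a compatible family, that is, a point of the inverse
    limit over the given class ([universal_image_threadable]).

    Surjectivity of the endpoint map follows: [Y] is [f(E)]-chain connected, as
    [X] is [E]-chain connected, so every point of [Y] is the endpoint of some
    class in [Y_(f(E))], which lifts. *)

(** * Concatenation and images of homotopies *)

Section homotopy_congruence.
Context {X : choiceType}.
Implicit Types (E : set (X * X)) (s t p q : seq X) (x y z : X).

Lemma is_chain_cat E x p q :
  is_chain E (x :: p ++ q) = is_chain E (x :: p) && is_chain E (last x p :: q).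
Proof. exact: cat_path. Qed.

Lemma is_chain_cons2 E x y p :
  is_chain E (x :: y :: p) = ((x, y) \in E) && is_chain E (y :: p).
Proof. by []. Qed.

Lemma chain_move_head s t x0 : chain_move s t -> head x0 s = head x0 t.
Proof. by case=> // -[|y s'] t'. Qed.

Lemma chain_move_cons s t x : chain_move s t -> chain_move (x :: s) (x :: t).
Proof.
case=> [a b y a0 b0|y]; first exact: (@move_add _ (x :: a) b y).
exact: (@move_add _ [:: x] [:: y] y).
Qed.

(** Moves fix the first point, so each intermediate chain can still be preceded
    by [x]. *)
Lemma homotopic_cons E s t x :
  homotopic E s t -> is_chain E (x :: s) -> homotopic E (x :: s) (x :: t).
Proof.
suff H : homotopic E s t -> is_chain E (x :: s) ->
    is_chain E (x :: t) /\ homotopic E (x :: s) (x :: t) by move=> /H h /h[].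
elim=> {s t} [s t [cs ct m]|s|s t u _ ihs _ iht] cxs.
- have hd : head x s = head x t by case: m => /(@chain_move_head _ _ x).
  have cxt : is_chain E (x :: t).
    case: s t cs ct hd cxs {m} => // y s [//|z t] _ ct /= yz.
    by rewrite yz => /andP[-> _]; exact: ct.
  split=> //; apply: rt_step; split=> //.
  by case: m => /(@chain_move_cons _ _ x); [left|right].
- by split=> //; exact: rt_refl.
- have [cxt st] := ihs cxs; have [cxu tu] := iht cxt.
  by split=> //; exact: rt_trans tu.
Qed.

Lemma homotopic_catl E x p q q' :
  homotopic E (last x p :: q) (last x p :: q') -> is_chain E (x :: p ++ q) ->
  homotopic E (x :: p ++ q) (x :: p ++ q').
Proof.
elim: p x => [//|y p ih] x h c; apply: homotopic_cons => //.
by apply: ih => //; case/andP: c.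
Qed.

Lemma homotopic_catr E x p p' q :
  homotopic E (x :: p) (x :: p') -> is_chain E (x :: p ++ q) ->
  homotopic E (x :: p ++ q) (x :: p' ++ q).
Proof.
move=> h; elim/last_ind: q => [|q z ih]; first by rewrite !cats0.
rewrite -!rcons_cat => c.
apply: (@homotopic_rcons _ E (x :: p ++ q) (x :: p' ++ q)) => //.
by apply: ih; move: c; rewrite /= rcons_path => /andP[].
Qed.

Lemma is_chain_map {Y : choiceType} (f : X -> Y) E (D : set (Y * Y)) s :
  map_pair f @` E `<=` D -> is_chain E s -> is_chain D (map f s).
Proof.
move=> ED; case: s => //= x p; rewrite path_map; apply: sub_path => y z /= Eyz.
by apply/mem_set/ED; exists (y, z) => //; exact/set_mem.
Qed.

Lemma homotopic_map {Y : choiceType} (f : X -> Y) E (D : set (Y * Y)) s t :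
  map_pair f @` E `<=` D -> homotopic E s t -> homotopic D (map f s) (map f t).
Proof.
move=> ED.
have mv u v : chain_move u v -> chain_move (map f u) (map f v).
  case=> [a b y a0 b0|y]; last exact: move_dup.
  by rewrite !map_cat /=; apply: move_add; [case: a a0|case: b b0].
elim=> {s t} [s t [cs ct m]|s|s t u _ st _ tu].
- apply: rt_step; split; [exact: is_chain_map cs|exact: is_chain_map ct|].
  by case: m => /mv; [left|right].
- exact: rt_refl.
- exact: rt_trans tu.
Qed.

End homotopy_congruence.

(** * Chains of a universal entourage *)

Section universal_entourages.
Context {X : uniformType}.
Implicit Types (E : sym_entourage X) (a b : X) (p q : seq X).

(** The chain [last a p :: r] is the reversal of [a :: p], a chain because [E] is
    symmetric; followed by [p] it cancels from the middle outwards, each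
    [z, y, z] losing first [y] and then the repeated [z]. *)
Lemma chain_inverse E a p : is_chain E (a :: p) ->
  exists r, [/\ is_chain E (last a p :: r), last (last a p) r = a &
    homotopic E (last a p :: r ++ p) [:: last a p]].
Proof.
elim/last_ind: p => [_|p z ih]; first by exists [::]; split=> //; exact: rt_refl.
rewrite last_rcons -rcons_cons is_chain_rcons //= => /andP[cp Eyz].
have [r [cr lr h]] := ih cp; set y := last a p in Eyz cr lr h *.
have Ezy : (z, y) \in ent_set E by apply/mem_set/sym_entC/set_mem.
have Ezz : (z, z) \in ent_set E by apply/mem_set; exact: sym_ent_refl.
have czyz : is_chain E [:: z; y; z] by rewrite /= Ezy Eyz.
have cyr : is_chain E (y :: r ++ rcons p z).
  by rewrite is_chain_cat cr lr /= rcons_path cp.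
have czyr : is_chain E (z :: y :: r ++ rcons p z) by rewrite is_chain_cons2 Ezy.
exists (y :: r); split=> //=; first by rewrite Ezy.
apply: (@rt_trans _ _ _ [:: z; y; z]).
  apply: homotopic_cons => //.
  have -> : y :: r ++ rcons p z = y :: (r ++ p) ++ [:: z] by rewrite -cats1 catA.
  apply: (@homotopic_catr _ _ y (r ++ p) [::] [:: z]) => //.
  by rewrite -catA cats1.
apply: (@rt_trans _ _ _ [:: z; z]).
  by apply: (@homotopic_insert _ E [:: z] y z) => //=; rewrite Ezz.
apply: homotopicC; apply: (@homotopic_dup _ E z [::]) => //.
Qed.

Context {x0 : X} {E : sym_entourage X} (univE : universal_ent x0 E).

Lemma universal_based_chain a :
  exists p, is_chain E (x0 :: p) /\ last x0 p = a.
Proof.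
have [g [_ gK _ _]] := univE.
have := gK a; rewrite /endpoint; case: (repr (g a)) => -[|x p] //= cp <-.
by case/andP: (cp) => /= c /eqP xx0; rewrite xx0 in c *; exists p.
Qed.

Lemma universal_chain a b : exists p, is_chain E (a :: p) /\ last a p = b.
Proof.
have [r [cr lr]] := universal_based_chain a.
have [q [cq lq]] := universal_based_chain b.
have [r' [cr' lr' _]] := chain_inverse _ _ _ cr; rewrite lr in cr' lr'.
by exists (r' ++ q); rewrite is_chain_cat last_cat lr' cr' cq.
Qed.

(** Injectivity of the endpoint map says this for chains that start at the
    basepoint; prefixing a chain [r] from the basepoint to [a], and then its
    reversal, reduces to that case. *)
Lemma universal_homotopic a p q : is_chain E (a :: p) -> is_chain E (a :: q) ->
  last a p = last a q -> homotopic E (a :: p) (a :: q).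
Proof.
move=> cp cq pq; have [r [cr lr]] := universal_based_chain a.
have [r' [cr' lr' h]] := chain_inverse _ _ _ cr; rewrite lr in cr' lr' h.
have crs s : is_chain E (a :: s) -> chain_from x0 E (x0 :: r ++ s).
  by move=> cs; rewrite /chain_from /= eqxx andbT -/(is_chain E (x0 :: _))
    is_chain_cat cr lr.
have cancel_rr' s : is_chain E (a :: s) ->
    homotopic E (a :: r' ++ r ++ s) (a :: s).
  move=> cs; rewrite catA; apply: (homotopic_catr _ a (r' ++ r) [::] s) => //.
  by rewrite -catA is_chain_cat cr' lr' is_chain_cat cr lr.
have hpq : homotopic E (x0 :: r ++ p) (x0 :: r ++ q).
  have [g [gK _ _ _]] := univE.
  apply/(chain_classP (BasedChain (crs _ cp)) (BasedChain (crs _ cq))).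
  by apply: (can_inj gK); rewrite !endpoint_class /= !last_cat lr.
apply: (rt_trans _ _ _ (a :: r' ++ r ++ p)).
  exact/homotopicC/cancel_rr'.
apply: (rt_trans _ _ _ (a :: r' ++ r ++ q)); last exact: cancel_rr'.
apply: homotopic_catl; rewrite ?is_chain_cat ?lr' //.
by rewrite cr' cr lr.
Qed.

End universal_entourages.

(** * Compatible families of chains *)

Section threads.
Context {Y : uniformType}.
Implicit Types (D F : sym_entourage Y) (c d : sym_entourage Y -> seq Y).

(** A point of the inverse limit by representatives, with an arbitrary starting
    point so that threads can be concatenated.  As in [is_chain E (y :: p)], the
    tails [c D] omit the starting point. *)
Definition thread (y z : Y) c :=
  [/\ forall D, is_chain D (y :: c D), forall D, last y (c D) = z &
    forall D D', D `<=` D' -> homotopic D' (y :: c D) (y :: c D')].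

Lemma thread_cat x y z c d :
  thread x y c -> thread y z d -> thread x z (fun D => c D ++ d D).
Proof.
move=> [cc lc hc] [cd ld hd].
have ccd D : is_chain D (x :: c D ++ d D) by rewrite is_chain_cat lc cc cd.
split=> [//|D|D D' DD']; first by rewrite last_cat lc ld.
have cDD' : is_chain D' (x :: c D ++ d D) by exact: is_chainS DD' (ccd D).
apply: (rt_trans _ _ _ (x :: c D ++ d D')).
  by apply: homotopic_catl => //; rewrite lc; exact: hd.
apply: homotopic_catr; first exact: hc.
by rewrite is_chain_cat (is_chainS DD' (cc D)) lc cd.
Qed.

Definition threadable F :=
  forall y p, is_chain F (y :: p) ->
    exists2 c, thread y (last y p) c & homotopic F (y :: c F) (y :: p).

(** Threads lifting the successive steps of a chain concatenate to one that
    lifts the chain. *)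
Lemma threadable_steps F :
  (forall y z, ent_set F (y, z) ->
    exists2 c, thread y z c & homotopic F (y :: c F) [:: y; z]) ->
  threadable F.
Proof.
move=> step y p; elim: p y => [|z p ih] y.
  move=> _; exists (fun=> [::]) => /=; last exact: rt_refl.
  by split=> // *; exact: rt_refl.
rewrite is_chain_cons2 => /andP[/set_mem Fyz cp].
have [c [cc lc hc] cF] := step _ _ Fyz.
have [d [cd ld hd] dF] := ih _ cp.
exists (fun D => c D ++ d D); first by apply: (thread_cat _ z); split.
apply: (rt_trans _ _ _ (y :: [:: z] ++ d F)).
  by apply: homotopic_catr => //; rewrite is_chain_cat lc cc cd.
apply: (homotopic_catl _ y [:: z]) => //.
by rewrite /= -/(is_chain F (z :: _)) cd andbT; apply/mem_set.
Qed.

Lemma tilde_proj_surj (y0 : Y) F : threadable F ->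
  set_surj [set: tilde y0] [set: chain_space y0 F] (@tilde_proj Y y0 F).
Proof.
move=> thF a _; rewrite -(chain_classK a).
case: (repr a) => -[|y p] //= cp.
case/andP: (cp) => /= cp' /eqP yy0; rewrite yy0 in cp cp' *.
have [c [cc lc hc] cF] := thF _ _ cp'.
have cf D : chain_from y0 D (y0 :: c D) by rewrite /chain_from cc /= eqxx.
pose u : prod_topology (fun E : sym_entourage Y => chain_space y0 E) :=
  fun D => chain_class (BasedChain (cf D)).
have uP : forall D D' (DD' : D' `<=` D), coarsen DD' (u D') = u D.
  move=> D D' DD'; rewrite coarsen_class; apply/chain_classP => /=.
  exact: hc.
exists (SigSub (mem_set uP)) => //.
by rewrite /tilde_proj /=; apply/chain_classP.
Qed.

(** Chain connectedness turns surjectivity of the projections into that of the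
    endpoint map: a point of [Y] is the endpoint of some class, which lifts. *)
Lemma coverable_threadable (y0 : Y) (B : set (sym_entourage Y)) :
  uniform_basis B -> B `<=` threadable ->
  (forall E y, B E -> exists p, is_chain E (y0 :: p) /\ last y0 p = y) ->
  coverable y0.
Proof.
move=> basB Bth conn.
split; last by exists B => // E /Bth; exact: tilde_proj_surj.
move=> y _; have [E BE _] := basB _ entourageT.
have [p [cp lp]] := conn _ y BE.
have cf : chain_from y0 E (y0 :: p) by rewrite /chain_from cp /= eqxx.
have [t _ tE] := tilde_proj_surj y0 _ (Bth _ BE) (chain_class (BasedChain cf)) I.
by exists t => //; rewrite (tilde_endpointE E) tE endpoint_class.
Qed.

End threads.

(** * Images of universal entourages *)

Section images_of_universal_entourages.
Context {X Y : uniformType} {x0 : X} {f : X -> Y} (univX : universal_space x0)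
  (ucf : forall V : sym_entourage Y, entourage (map_pair f @^-1` V)).

Lemma universal_sub (V : set (X * X)) : entourage V ->
  exists2 E : sym_entourage X, universal_ent x0 E & E `<=` V.
Proof.
by move=> entV; have [B basB uB] := univX; have [E /uB] := basB _ entV; exists E.
Qed.

(** [E] and [E'] are unrelated, so the two chains are compared in [Y] through a
    chain of a universal entourage [U] finer than both, which is homotopic to
    each of them before [f] is applied. *)
Lemma universal_image_homotopic (D : sym_entourage Y) (E E' : sym_entourage X) a p q :
    universal_ent x0 E -> universal_ent x0 E' ->
    map_pair f @` E `<=` D -> map_pair f @` E' `<=` D ->
    is_chain E (a :: p) -> is_chain E' (a :: q) -> last a p = last a q ->
  homotopic D (map f (a :: p)) (map f (a :: q)).
Proof.
move=> uE uE' ED ED' cp cq pq.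
have [U uU UEE'] := universal_sub _ (ent_setP (sym_entI E E')).
have UE : U `<=` E by move=> z /UEE'[].
have UE' : U `<=` E' by move=> z /UEE'[].
have [r [cr lr]] := universal_chain uU a (last a p).
apply: (rt_trans _ _ _ (map f (a :: r))).
- apply: (homotopic_map _ _ _ _ _ ED); apply: (universal_homotopic uE) => //.
  exact: is_chainS UE cr.
- apply: (homotopic_map _ _ _ _ _ ED'); apply: (universal_homotopic uE') => //.
    exact: is_chainS UE' cr.
  by rewrite lr.
Qed.

(** A step [(f a, f b)] with [(a, b)] in [E] is threaded by images of chains
    from [a] to [b] of ever finer universal entourages. *)
Lemma universal_image_threadable (F : sym_entourage Y) (E : sym_entourage X) :
  universal_ent x0 E -> map_pair f @` E = F -> threadable F.
Proof.
move=> uE EF; apply: threadable_steps => y z Fyz.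
have [[a b] Eab [<- <-]] : (map_pair f @` E) (y, z) by rewrite EF.
have H (D : sym_entourage Y) : exists Up : sym_entourage X * seq X,
    [/\ universal_ent x0 Up.1, map_pair f @` Up.1 `<=` D,
        is_chain Up.1 (a :: Up.2) & last a Up.2 = b].
  have [U uU UD] := universal_sub _ (ucf D).
  have [p [cp lp]] := universal_chain uU a b.
  by exists (U, p); split=> //; exact/image_subP.
have [Up UpP] := choice H.
exists (fun D => map f (Up D).2).
- split=> [D|D|D D' DD'].
  + by have [_ UD cp _] := UpP D; exact: (is_chain_map f _ _ (_ :: _) UD).
  + by have [_ _ _ lp] := UpP D; rewrite last_map lp.
  + have [uU UD cp lp] := UpP D; have [uU' UD' cp' lp'] := UpP D'.
    apply: (universal_image_homotopic D' _ _ a _ _ uU uU') => //.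
      exact: subset_trans DD'.
    by rewrite lp.
- have [uU UD cp lp] := UpP F.
  (* the step itself is the image of the E-chain a, b *)
  apply: (universal_image_homotopic F _ _ a _ [:: b] uU uE) => //.
    by rewrite EF.
  by rewrite /= andbT; apply/mem_set.
Qed.

End images_of_universal_entourages.

Theorem corollary13 (X Y : uniformType) (x0 : X) (y0 : Y) (f : X -> Y)
    (univX : universal_space x0)
    (buf : bi_unif_continuous f)
    (surjf : set_surj [set: X] [set: Y] f) :
  coverable y0.
Proof.
have [ucf openf] := buf.
have surj y : exists x, f x = y by have [x _ <-] := surjf y I; exists x.
(* x1 takes the part of the basepoint x0, whose image need not be y0 *)
have [x1 fx1] := surj y0.
pose B := [set F : sym_entourage Y |
  exists2 E : sym_entourage X, universal_ent x0 E & map_pair f @` E = F].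
apply: (coverable_threadable y0 B).
- move=> V entV; have [E uE EV] := universal_sub univX _ (ucf (sym_ent_of entV)).
  have entfE : entourage (map_pair f @` E).
    have [W entW ->] := openf E; apply: filterS entW => -[y z] Wyz; split=> //.
    by split=> /=; [have [x <-] := surj y|have [x <-] := surj z]; exists x.
  have symfE : ((map_pair f @` E)^-1)%relation = map_pair f @` E.
    by apply/seteqP; split=> -[y z] [[a b] Eab [<- <-]]; exists (b, a) => //;
      exact: sym_entC.
  exists (SymEntourage entfE symfE); first by exists E.
  by move=> _ [ab Eab <-]; have [] := EV _ Eab.
- by move=> F [E uE EF]; exact: (universal_image_threadable univX ucf _ _ uE EF).
- move=> F y [E uE EF]; have [x <-] := surj y.
  have [p [cp lp]] := universal_chain uE x1 x.
  exists (map f p); rewrite -fx1 last_map lp; split=> //.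
  by apply: (is_chain_map f E F (x1 :: p)) => //; rewrite EF.
Qed.
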